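(* For all integers $m\geq 1$, $r\geq 1$ and $q\geq 2$, $$S_{r^m,q}=\sum_{\xi\in\mathcal{C}_m}\binom{m}{\xi_1,\xi_2,\ldots,\xi_p}\big\{\zeta(q,r\xi_1,r\xi_2,\ldots,r\xi_p)+\zeta(q+r\xi_1,r\xi_2,\ldots,r\xi_p)\big\},$$ where $\xi=(\xi_1,\xi_2,\ldots,\xi_p)$ and $p$ is the number of parts of $\xi$.
   Context: Generalized harmonic numbers: $H_n^{(r)}=\sum_{k=1}^n k^{-r}$ for positive integers $n,r$. Euler sum: $S_{r^m,q}=\sum_{n=1}^{\infty}\frac{(H_n^{(r)})^m}{n^q}$. Multiple zeta values: for positive integers $s_1,\ldots,s_k$ with $s_1>1$, $\zeta(s_1,s_2,\ldots,s_k)=\sum_{n_1>n_2>\cdots>n_k\geq 1}\frac{1}{n_1^{s_1}n_2^{s_2}\cdots n_k^{s_k}}$. A composition of $m$ is an ordered tuple of positive integers whose elements sum to $m$; $\mathcal{C}_m$ is the set of all compositions of $m$. Multinomial coefficients: $\binom{m}{\xi_1,\xi_2,\ldots,\xi_p}=\frac{m!}{\xi_1!\,\xi_2!\cdots\xi_p!}$. *)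

(* Defs.v *)
From mathcomp Require Import all_boot all_order all_algebra.
From mathcomp Require Import all_classical all_reals all_analysis.

Set Implicit Arguments.
Unset Strict Implicit.
Unset Printing Implicit Defensive.

Import Order.TTheory GRing.Theory Num.Theory.

Local Open Scope classical_set_scope.
Local Open Scope ring_scope.

Definition harmonic_number (R : realType) (r n : nat) : R :=
  \sum_(1 <= k < n.+1) (k%:R ^+ r)^-1.

(* S_{r^m,q}. The terms are nonnegative, so the limit of the partial sums always
   exists in \bar R; the series converges iff this value is finite. *)
Definition euler_sum (R : realType) (r m q : nat) : \bar R :=
  (\sum_(1 <= n <oo) (harmonic_number R r n ^+ m / n%:R ^+ q)%:E)%E.

(* The summation range n_1 > n_2 > ... > n_k >= 1. *)
Definition mzv_index (k : nat) : set (seq nat) :=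
  [set n | [&& size n == k, sorted gtn n & all (leq 1) n]].

(* zeta(s_1, ..., s_k) for s = [:: s_1; ...; s_k]: an unordered sum of
   nonnegative terms, equal to +oo if it diverges. *)
Definition mzv (R : realType) (s : seq nat) : \bar R :=
  \esum_(n in mzv_index (size s))
    (\prod_(i < size s) ((nth 0%N n i)%:R ^+ nth 0%N s i)^-1)%:E.

Definition compositions (m : nat) : set (seq nat) :=
  [set xi | all (leq 1) xi && (sumn xi == m)].

(* Sums \sum_(xi \in compositions m) are junk-free: the index set is finite. *)
Lemma finite_compositions (m : nat) : finite_set (compositions m).
Proof.
have [k] := ubnP m; elim: k m => // k IHk m lemk.
apply: (@sub_finite_set _ _ ([set [::]] `|`
  \bigcup_(i in `I_m) (cons i.+1 @` compositions (m - i.+1)))).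
  move=> [|[|x] xi] /= /andP[pos /eqP sxi]; [by left| by []|right].
  exists x; first by rewrite /= -sxi leq_addr.
  by exists xi; rewrite // -sxi addKn; apply/andP; split.
rewrite finite_setU; split; first exact: finite_set1.
apply: bigcup_finite => // i /= ltim; apply/finite_image/IHk.
by rewrite ltnS in lemk; apply: leq_trans lemk; rewrite ltn_subrL (leq_trans _ ltim).
Qed.

Definition multinomial (R : realType) (m : nat) (xi : seq nat) : R :=
  m`!%:R / \prod_(x <- xi) x`!%:R.

(* Main.v *)
(* Let Z_n(s) be the multiple zeta value truncated to n_1 < n, so that
   zeta(a, s) = \sum_n n^-a Z_n(s).  Writing H_(k)^m - H_(k-1)^m by the binomial
   formula with increment k^-r, telescoping over k, and splitting a composition
   of m into its first part j and a composition of m - j, strong induction on m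
   gives H_(n-1)^m = \sum_xi multinomial(xi) Z_n(r xi).  Then
   Z_(n+1)(r xi) = Z_n(r xi) + n^(- r xi_1) Z_n(r xi_2, ..., r xi_p), and summing
   against n^-q produces the two zeta values.  Everything is nonnegative, so
   the sums can be interchanged in the extended reals; finiteness of the Euler
   sum is proved separately by Abel summation. *)
Require Import Defs.
From mathcomp Require Import all_boot all_order all_algebra.
From mathcomp Require Import all_classical all_reals all_analysis.
From mathcomp Require Import ring lra.

Import Order.TTheory GRing.Theory Num.Theory.

Local Open Scope classical_set_scope.
Local Open Scope ring_scope.

(** * Truncated multiple zeta values as sums over decreasing chains *)

Fixpoint truncated_mzv (R : realType) (s : seq nat) (N : nat) : R :=
  if s is a :: s' then
    \sum_(1 <= k < N) (k%:R ^+ a)^-1 * truncated_mzv R s' k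
  else 1.

Lemma truncated_mzv_ge0 (R : realType) s N : 0 <= truncated_mzv R s N.
Proof.
elim: s N => //= a s IHs N; apply: sumr_ge0 => k _.
by rewrite mulr_ge0 ?IHs ?invr_ge0 ?exprn_ge0.
Qed.

(** The index tuples behind [truncated_mzv]: in a decreasing path starting from [N], each entry is
    the strict bound for the next, which matches the recursion. *)
Definition chains (l N : nat) : set (seq nat) :=
  [set t | [&& size t == l, path gtn N t & all (leq 1) t]].

(** Lists with different heads differ, so the union is disjoint, and [cons k] is injective. *)
Lemma esum_cons_chains (R : realType) (K : set nat) (l : nat)
    (f : seq nat -> \bar R) : (forall t, (0 <= f t)%E) ->
  \esum_(t in \bigcup_(k in K) (cons k @` chains l k)) f t =
  \esum_(k in K) \esum_(t in chains l k) f (k :: t).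
Proof.
move=> f0; rewrite esum_bigcupT//; last first.
  by apply/trivIsetP => i j _ _ ij; rewrite -subset0 => _ [[t _ <-] [u _ [ji]]];
    rewrite ji eqxx in ij.
by apply: eq_esum => k _; rewrite esum_image// => x y _ _ [].
Qed.

Lemma chainsS l N : chains l.+1 N =
  \bigcup_(k in [set k | (1 <= k < N)%N]) (cons k @` chains l k).
Proof.
apply/seteqP; split=> [[|k t]//= /and3P[st /andP[kN pt] /andP[k0 a]]|].
  by exists k; rewrite /= ?k0//; exists t => //=; apply/and3P.
move=> _ [k /= /andP[k0 kN]] [t /= /and3P[st pt a] <-].
by rewrite /chains /= eqSS st kN pt k0.
Qed.

Lemma mzv_indexS l : mzv_index l.+1 =
  \bigcup_(k in [set k | (1 <= k)%N]) (cons k @` chains l k).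
Proof.
apply/seteqP; split=> [[|k t]//= /and3P[st pt /andP[k0 a]]|].
  by exists k => //; exists t => //=; apply/and3P.
move=> _ [k /= k0] [t /= /and3P[st pt a] <-].
by rewrite /mzv_index /= eqSS st pt k0.
Qed.

Lemma mzv_term_ge0 (R : realType) (s n : seq nat) :
  0 <= \prod_(i < size s) ((nth 0%N n i)%:R ^+ nth 0%N s i)^-1 :> R.
Proof. by apply: prodr_ge0 => i _; rewrite invr_ge0 exprn_ge0. Qed.

(* The scalar [c] makes the induction go through without a homogeneity lemma
   for [esum]. *)
Lemma esum_chains (R : realType) (s : seq nat) (N : nat) (c : R) : 0 <= c ->
  \esum_(n in chains (size s) N)
    (c * \prod_(i < size s) ((nth 0%N n i)%:R ^+ nth 0%N s i)^-1)%:E =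
  (c * truncated_mzv R s N)%:E.
Proof.
elim: s N c => [|a s IHs] N c c0 /=.
  rewrite (_ : chains 0 N = [set [::]]); last first.
    by apply/seteqP; split=> [[]|_ ->]//.
  by rewrite esum_set1 big_ord0 ?mulr1 ?lee_fin.
rewrite chainsS esum_cons_chains; last first.
  by move=> t; rewrite lee_fin mulr_ge0// (mzv_term_ge0 R (a :: s)).
under eq_esum => k _.
  under eq_esum => t _ do rewrite big_ord_recl /= mulrA.
  rewrite IHs; last by rewrite mulr_ge0// invr_ge0 exprn_ge0.
  over.
rewrite (_ : [set k | _] = [set` index_iota 1 N]); last first.
  by apply/seteqP; split=> k /=; rewrite mem_index_iota.
rewrite esum_fset; [|exact: finite_seq|]; last first.
  by move=> k _; rewrite lee_fin !mulr_ge0 ?truncated_mzv_ge0.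
rewrite -fsbig_seq ?iota_uniq// sumEFin mulr_sumr.
by under eq_bigr => k _ do rewrite -mulrA.
Qed.

(** Fixing the largest index [n] leaves chains below [n], which sum to a truncated value. *)
Lemma mzv_cons (R : realType) (a : nat) (s : seq nat) :
  mzv R (a :: s) =
  (\sum_(1 <= n <oo) ((n%:R ^+ a)^-1 * truncated_mzv R s n)%:E)%E.
Proof.
rewrite /mzv /= mzv_indexS esum_cons_chains; last first.
  by move=> t; rewrite lee_fin (mzv_term_ge0 R (a :: s)).
under eq_esum => k _.
  under eq_esum => t _ do rewrite big_ord_recl /=.
  rewrite esum_chains ?invr_ge0 ?exprn_ge0//; over.
rewrite eseries_cond nneseries_esum// => n _.
by rewrite lee_fin mulr_ge0 ?truncated_mzv_ge0// invr_ge0 exprn_ge0.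
Qed.

(** * Compositions and multinomial coefficients *)

Definition comps (m : nat) : seq (seq nat) :=
  finmap.enum_fset (fset_set (compositions m)).

Lemma mem_comps m xi : (xi \in comps m) = all (leq 1) xi && (sumn xi == m).
Proof.
rewrite (in_fset_set (finite_compositions m)).
by apply/idP/idP => [/set_mem|c]; [|exact: mem_set].
Qed.

Lemma compsS m : perm_eq (comps m.+1)
  [seq j :: xi | j <- index_iota 1 m.+2, xi <- comps (m.+1 - j)].
Proof.
apply: uniq_perm; first exact: finmap.fset_uniq.
  apply: allpairs_uniq_dep; first exact: iota_uniq.
    by move=> j _; exact: finmap.fset_uniq.
  by move=> [i x] [j y] _ _ /= [-> ->].
move=> xi; rewrite mem_comps; apply/idP/allpairsPdep => [|[j [t []]]].
  case: xi => [|j t] //= /andP[/andP[j0 a]] /eqP jt.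
  exists j, t; split=> //; first by rewrite mem_index_iota j0 ltnS -jt leq_addr.
  by rewrite mem_comps a -jt addKn/=.
rewrite mem_index_iota mem_comps ltnS => /andP[j0 jm] /andP[a /eqP st] ->.
by rewrite /= j0 a st subnKC/=.
Qed.

Lemma comps0 : perm_eq (comps 0) [:: [::]].
Proof.
apply: uniq_perm => //; first exact: finmap.fset_uniq.
by move=> [|[|x] xi]; rewrite mem_comps inE //= andbF.
Qed.

Lemma multinomial_cons (R : realType) m j xi : (j <= m)%N ->
  multinomial R m (j :: xi) = 'C(m, j)%:R * multinomial R (m - j) xi.
Proof.
move=> jm; rewrite /multinomial big_cons -(bin_fact jm) !natrM invfM.
have j0 : j`!%:R != 0 :> R by rewrite pnatr_eq0 -lt0n fact_gt0.
by rewrite !mulrA; congr (_ * _); field.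
Qed.

Lemma multinomial_ge0 (R : realType) m xi : 0 <= multinomial R m xi.
Proof. by rewrite divr_ge0// prodr_ge0. Qed.

(** * Powers of harmonic numbers *)

Lemma harmonicS (R : realType) r n :
  harmonic_number R r n.+1 = harmonic_number R r n + (n.+1%:R ^+ r)^-1.
Proof. by rewrite /harmonic_number big_nat_recr. Qed.

Lemma harmonic_ge0 (R : realType) r n : 0 <= harmonic_number R r n.
Proof. by apply: sumr_ge0 => k _; rewrite invr_ge0 exprn_ge0. Qed.

(** The binomial formula with the term [j = 0] set apart; the remaining [j] range over the possible
    first parts of a composition of [m]. *)
Lemma exprD_tail (R : realType) (x y : R) m :
  (x + y) ^+ m = x ^+ m +
    \sum_(1 <= j < m.+1) 'C(m, j)%:R * (y ^+ j * x ^+ (m - j)).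
Proof.
rewrite exprDn -(big_mkord predT (fun i => x ^+ (m - i) * y ^+ i *+ 'C(m, i))).
rewrite big_nat_recl// subn0 bin0 expr0 mulr1 mulr1n big_add1/=.
by congr (_ + _); apply: eq_bigr => j _; rewrite [RHS]mulr_natl [y ^+ _ * _]mulrC.
Qed.

Lemma harmonic_expr (R : realType) r m n :
  harmonic_number R r n ^+ m =
  \sum_(xi <- comps m) multinomial R m xi *
    truncated_mzv R [seq (r * x)%N | x <- xi] n.+1.
Proof.
have [k] := ubnP m; elim: k m n => // k IHk [|m] n; rewrite ltnS => mk.
  rewrite expr0 (perm_big _ comps0) big_seq1 /= mulr1.
  by rewrite /multinomial big_nil divr1 fact0.
rewrite (perm_big _ (compsS m)) big_allpairs_dep /=.
elim: n => [|n IHn].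
  rewrite big1 => [|j _]; last by rewrite big1// => xi _; rewrite big_geq ?mulr0.
  by rewrite /harmonic_number big_geq// expr0n.
(* For each first part [j], the binomial term is matched with the last term [k = n.+1] of the
   outermost truncated sum. *)
rewrite harmonicS exprD_tail IHn -big_split /= !big_nat; apply: eq_bigr => j.
rewrite ltnS => /andP[j0 jm].
rewrite IHk; last by rewrite (leq_trans _ mk)// ltn_subrL j0.
rewrite !mulr_sumr -big_split /=; apply: eq_bigr => xi _.
rewrite [in RHS]big_nat_recr//= mulrDr multinomial_cons//; congr (_ + _).
by rewrite exprVn -exprM; ring.
Qed.

(** Separates the terms with largest index exactly [n]. As [m > 0], compositions are nonempty and
    [head] never takes its default. *)
Lemma harmonic_expr_split (R : realType) r m n : (0 < m)%N -> (0 < n)%N ->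
  harmonic_number R r n ^+ m =
  \sum_(xi <- comps m) multinomial R m xi *
    (truncated_mzv R [seq (r * x)%N | x <- xi] n +
     (n%:R ^+ (r * head 0%N xi))^-1 *
       truncated_mzv R [seq (r * x)%N | x <- behead xi] n).
Proof.
move=> m0 n0; rewrite harmonic_expr !big_seq; apply: eq_bigr => xi.
rewrite mem_comps; case: xi => [|x xi _] /=; first by case: m m0.
by rewrite big_nat_recr.
Qed.

(** * Finiteness of the Euler sum *)

(** Convexity: the tangent to the [m]-th power at [x + y] lies below its graph at [x]. *)
Lemma exprD_le_tangent (R : realType) (x y : R) m : 0 <= x -> 0 <= y ->
  (x + y) ^+ m <= x ^+ m + m%:R * y * (x + y) ^+ m.-1.
Proof.
move=> x0 y0; elim: m => [|m IHm]; first by rewrite !expr0 !mul0r addr0.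
have xy0 : 0 <= x + y by rewrite addr_ge0.
have le_xy : x ^+ m <= (x + y) ^+ m by rewrite lerXn2r// lerDl.
have : x * (x + y) ^+ m <= x * (x ^+ m + m%:R * y * (x + y) ^+ m.-1).
  exact: ler_wpM2l.
have : x * (m%:R * y * (x + y) ^+ m.-1) <= m%:R * y * (x + y) ^+ m.
  case: m {IHm le_xy} => [|m /=]; first by rewrite !mul0r mulr0.
  by rewrite mulrCA ler_wpM2l ?mulr_ge0// exprS ler_wpM2r ?exprn_ge0// lerDl.
rewrite !exprS -natr1 /= mulrDl => h1; rewrite mulrDr => h2.
lra.
Qed.

(* Abel summation against 1/k - 1/(k+1) trades the power m for m - 1. *)
Lemma harmonic_abel (R : realType) r m N : (1 <= r)%N ->
  \sum_(1 <= n < N.+1) harmonic_number R r n ^+ m / n%:R ^+ 2 +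
    2 * (harmonic_number R r N.+1 ^+ m / N.+1%:R) <=
  2 + 2 * m%:R *
    \sum_(1 <= n < N.+2) harmonic_number R r n ^+ m.-1 / n%:R ^+ 2.
Proof.
move=> r1; elim: N => [|N IHN].
  rewrite big_geq// add0r {1}/harmonic_number big_nat1 !(expr1n, invr1, mulr1).
  rewrite lerDl !mulr_ge0// sumr_ge0// => n _.
  by rewrite divr_ge0 ?exprn_ge0 ?harmonic_ge0.
rewrite big_nat_recr//= [in leRHS]big_nat_recr//=.
move: (\sum_(1 <= n < N.+1) _) (\sum_(1 <= n < N.+2) _) IHN => S S' IHN.
set k : R := N.+1%:R; set x := harmonic_number R r N.+1 in IHN *.
have k1 : 1 <= k by rewrite ler1n.
have x0 : 0 <= x := harmonic_ge0 R r N.+1.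
rewrite -[N.+2%:R]natr1 -/k.
have d0 : 0 <= (N.+2%:R ^+ r)^-1 :> R by rewrite invr_ge0 exprn_ge0.
have d1 : (N.+2%:R ^+ r)^-1 <= (k + 1)^-1.
  rewrite /k natr1 lef_pV2 ?posrE ?exprn_gt0 ?ltr0n//.
  by rewrite -[leLHS]expr1 ler_weXn2l// ler1n.
have := exprD_le_tangent R x _ m x0 d0; rewrite -harmonicS.
set X := harmonic_number R r N.+2 => hX.
have X0 : 0 <= X := harmonic_ge0 R r N.+2.
(* Since [r >= 1], the increment is at most [1/(k+1)], so the tangent error is a term of the series
   for [m.-1]. *)
have hX' : X ^+ m / (k + 1) <= x ^+ m / (k + 1) + m%:R * (X ^+ m.-1 / (k + 1) ^+ 2).
  have k1V : 0 <= (k + 1)^-1 by rewrite invr_ge0; lra.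
  rewrite expr2 invfM; apply: le_trans (ler_wpM2r k1V hX) _.
  rewrite mulrDl lerD2l !mulrA ler_wpM2r// mulrAC ler_wpM2l//.
  by rewrite mulr_ge0 ?exprn_ge0.
(* The constant 2 comes from [1/k^2 <= 2 (1/k - 1/(k+1))], an equality at [k = 1]. *)
have hk : x ^+ m / k ^+ 2 + 2 * (x ^+ m / (k + 1)) <= 2 * (x ^+ m / k).
  rewrite -subr_ge0 (_ : _ - _ = x ^+ m * ((k - 1) / (k ^+ 2 * (k + 1)))).
    by rewrite mulr_ge0 ?exprn_ge0// divr_ge0 ?subr_ge0// mulr_ge0 ?exprn_ge0; lra.
  by field; rewrite gt_eqF /= ?gt_eqF//; lra.
move: (X ^+ m / _) (X ^+ m.-1 / _) (x ^+ m / (k + 1)) (x ^+ m / k ^+ 2)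
  (x ^+ m / k) hX' hk IHN => A B C D E hX' hk IHN.
by lra.
Qed.

Lemma harmonic_series_bounded (R : realType) r m : (1 <= r)%N ->
  exists C : R, forall N,
    \sum_(1 <= n < N) harmonic_number R r n ^+ m / n%:R ^+ 2 <= C.
Proof.
move=> r1; elim: m => [|m [C IHm]].
  exists 2 => -[|N]; first by rewrite big_geq.
  have := harmonic_abel R r 0 N r1; rewrite mulr0 mul0r addr0; apply: le_trans.
  by rewrite lerDl mulr_ge0// divr_ge0.
exists (2 + 2 * m.+1%:R * C) => -[|N].
  rewrite big_geq// addr_ge0// !mulr_ge0//.
  by apply: le_trans (IHm 0%N); rewrite big_geq.
apply: (@le_trans _ _ (2 + 2 * m.+1%:R *
   \sum_(1 <= n < N.+2) harmonic_number R r n ^+ m / n%:R ^+ 2)).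
  apply: le_trans (harmonic_abel R r m.+1 N r1).
  by rewrite lerDl mulr_ge0// divr_ge0 ?exprn_ge0 ?harmonic_ge0.
by rewrite lerD2l ler_wpM2l.
Qed.

(** Termwise comparison with the case [q = 2]. *)
Lemma euler_sum_fin_num (R : realType) r m q : (1 <= r)%N -> (2 <= q)%N ->
  euler_sum R r m q \is a fin_num.
Proof.
move=> r1 q2; have [C HC] := harmonic_series_bounded R r m r1.
have t0 n : (0 <= (harmonic_number R r n ^+ m / n%:R ^+ q)%:E)%E.
  by rewrite lee_fin divr_ge0 ?exprn_ge0 ?harmonic_ge0.
rewrite ge0_fin_numE; last by apply: nneseries_ge0 => n _ _; exact: t0.
apply: (@le_lt_trans _ _ C%:E); last exact: ltry.
apply: lime_le; first by apply: is_cvg_nneseries => n _ _; exact: t0.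
apply: nearW => N; rewrite sumEFin lee_fin; apply: le_trans (HC N).
rewrite !big_nat; apply: ler_sum => n /andP[n1 _].
rewrite ler_wpM2l ?exprn_ge0 ?harmonic_ge0// lef_pV2 ?posrE ?exprn_gt0 ?ltr0n//.
by rewrite ler_weXn2l// ler1n.
Qed.

Local Open Scope ereal_scope.

Theorem theorem3p4 (R : realType) (m r q : nat)
    (hm : (1 <= m)%N) (hr : (1 <= r)%N) (hq : (2 <= q)%N) :
  euler_sum R r m q \is a fin_num /\
  euler_sum R r m q =
    \sum_(xi \in compositions m)
      (multinomial R m xi)%:E *
      (mzv R (q :: [seq (r * x)%N | x <- xi]) +
       mzv R ((q + r * head 0%N xi)%N :: [seq (r * x)%N | x <- behead xi])).
Proof.
split; first exact: euler_sum_fin_num.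
have t0 a s n : 0 <= ((n%:R ^+ a)^-1 * truncated_mzv R s n)%:E.
  by rewrite lee_fin mulr_ge0 ?truncated_mzv_ge0// invr_ge0 exprn_ge0.
rewrite (fsbig_finite _ _ (finite_compositions m)) -/(comps m).
under [RHS]eq_bigr => xi _.
  rewrite !mzv_cons -nneseriesD; [|by move=> *; exact: t0..].
  rewrite -nneseriesZl; last by move=> n _; rewrite adde_ge0.
  over.
rewrite -nneseries_sum; last first.
  by move=> xi n _; rewrite mule_ge0 ?adde_ge0// lee_fin multinomial_ge0.
(* Turning the lower summation bound into a condition makes [0 < n] available termwise. *)
rewrite /euler_sum eseries_cond [RHS]eseries_cond.
apply: eq_eseriesr => n; rewrite andTb => n0.
under [RHS]eq_bigr => xi _ do rewrite -EFinD -EFinM.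
rewrite sumEFin harmonic_expr_split// mulr_suml; congr EFin; apply: eq_bigr => xi _.
by rewrite -mulrA exprD invfM; congr *%R; ring.
Qed.
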